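(* Let $E := L^0(\mathbb{C},\mu)$ be the complex topological vector space of equivalence classes of measurable functions $\mathbb{C}\to\mathbb{C}$ (modulo functions vanishing $\mu$-almost everywhere) with the topology of convergence in measure, where $\mu$ is the Gauss measure on $\mathbb{C}=\mathbb{R}^2$. Let $f\colon \mathbb{C}\to E$, $f(z):=\mathbf{1}_{A(z)}$, where $A(z):=\{w\in\mathbb{C} : \operatorname{Re}(w)\le \operatorname{Re}(z)\text{ and }\operatorname{Im}(w)\le\operatorname{Im}(z)\}$. Then $f$ is of class $C^\infty_{\mathbb{C}}$, $f$ is injective, and $f^{(j)}(z)=0$ for all $j\in\mathbb{N}=\{1,2,\ldots\}$ and all $z\in\mathbb{C}$. In particular, $f$ is not given locally by its Taylor series around any point; that is, for no $z_0\in\mathbb{C}$ is there a neighbourhood of $z_0$ on which $f(z)=\sum_{j=0}^\infty \frac{1}{j!}(z-z_0)^j f^{(j)}(z_0)$ holds for all $z$.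
   Context: Gauss measure: $d\nu(x)=\frac{1}{\sqrt{\pi}}e^{-x^2}\,dx$ on $\mathbb{R}$ and $\mu:=\nu\otimes\nu$ on $\mathbb{C}=\mathbb{R}^2$. Topology on $E=L^0(\mathbb{C},\mu)$: a basis of open zero-neighbourhoods is given by the sets $W_k$, $k\in\mathbb{N}$, consisting of the classes of measurable $\gamma\colon\mathbb{C}\to\mathbb{C}$ with $\mu(\{z\in\mathbb{C}: |\gamma(z)|\ge \frac1k\})<\frac1k$. For measurable $A\subseteq\mathbb{C}$, $\mathbf{1}_A$ denotes (the class of) the characteristic function of $A$. Differentiability classes: let $\mathbb{K}$ be a non-discrete topological field (here $\mathbb{K}=\mathbb{C}$), $U\subseteq\mathbb{K}$ open, $E$ a Hausdorff topological $\mathbb{K}$-vector space and $f\colon U\to E$ a map. $f$ is of class $C^0_{\mathbb{K}}$ if it is continuous; then $f^{<0>}:=f$. Recursively, for $k\in\mathbb{N}$, $f$ is of class $C^k_{\mathbb{K}}$ if it is of class $C^{k-1}_{\mathbb{K}}$ and there is a continuous map $f^{<k>}\colon U^{k+1}\to E$ such that $$f^{<k>}(x_1,\ldots,x_{k+1})=\frac{1}{x_1-x_2}\left(f^{<k-1>}(x_1,x_3,\ldots,x_{k+1})-f^{<k-1>}(x_2,x_3,\ldots,x_{k+1})\right)$$ for all $(x_1,\ldots,x_{k+1})\in U^{k+1}$ with $x_1\ne x_2$ (such $f^{<k>}$ is unique). $f$ is of class $C^\infty_{\mathbb{K}}$ if it is of class $C^k_{\mathbb{K}}$ for all $k\in\mathbb{N}_0$.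 The derivatives are $f^{(0)}=f$ and $f^{(k)}(x)=\frac{d^kf}{dx^k}(x)$ (iterated derivatives, defined as limits of difference quotients), and $f^{(k)}(x)=k!\,f^{<k>}(x,\ldots,x)$ if $f$ is of class $C^k_{\mathbb{K}}$. *)

(* Defs.v *)
From HB Require Import structures.
From mathcomp Require Import all_boot all_order all_algebra.
From mathcomp Require Import all_classical all_reals all_analysis.
From mathcomp Require Import measurable_realfun.
From mathcomp Require Import complex ring.

Set Implicit Arguments.
Unset Strict Implicit.
Unset Printing Implicit Defensive.

Import Order.TTheory GRing.Theory Num.Theory.
Import numFieldNormedType.Exports.

Local Open Scope classical_set_scope.
Local Open Scope ring_scope.
Local Open Scope complex_scope.
Local Open Scope quotient_scope.

(* R[i] carries no topology by default; this is the one given by its modulus. *)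
HB.instance Definition _ (R : rcfType) := NormedModule.copy R[i] R[i]^o.

Section complex_measurable.
Context {R : realType}.

Definition complex_pair (z : R[i]) : measurableTypeR R * measurableTypeR R :=
  (complex.Re z, complex.Im z).

(* The sigma-algebra of the plane, transported along R[i] = R * R. *)
Definition complex_measurable : set (set R[i]) :=
  preimage_set_system setT complex_pair measurable.

Let cm0 : complex_measurable set0.
Proof. by exists set0 => //; rewrite preimage_set0 setI0. Qed.

Let cmC A : complex_measurable A -> complex_measurable (~` A).
Proof.
case=> B mB <-; exists (~` B); first exact: measurableC.
by rewrite !setTI preimage_setC.
Qed.

Let cm_bigcup (F : (set R[i])^nat) :
  (forall i, complex_measurable (F i)) -> complex_measurable (\bigcup_i F i).
Proof.
move=> mF; have /= mF' i := cid2 (mF i).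
exists (\bigcup_i (s2val (mF' i))).
  by apply: bigcup_measurable => k _; case: (mF' k).
rewrite setTI preimage_bigcup; apply: eq_bigcupr => i _.
by case: (mF' i) => B mB /= <-; rewrite setTI.
Qed.

HB.instance Definition _ := @isMeasurable.Build default_measure_display R[i]
  complex_measurable cm0 cmC cm_bigcup.

Lemma measurable_complex_pair : measurable_fun setT complex_pair.
Proof. by move=> _ B mB; exists B. Qed.

Lemma measurable_fun_complexP d (T : measurableType d) (f : T -> R[i]) :
  measurable_fun setT f <->
  measurable_fun setT (fun x => complex.Re (f x) : measurableTypeR R) /\
  measurable_fun setT (fun x => complex.Im (f x) : measurableTypeR R).
Proof.
transitivity (measurable_fun setT (complex_pair \o f)); last first.
  by rewrite measurable_fun_pairP.
split=> mf; first exact: measurableT_comp measurable_complex_pair mf.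
by move=> _ _ [B mB <-]; rewrite setTI; exact: mf.
Qed.

Definition pair_complex (p : measurableTypeR R * measurableTypeR R) : R[i] :=
  p.1 +i* p.2.

Lemma measurable_pair_complex : measurable_fun setT pair_complex.
Proof.
apply/measurable_fun_complexP; split=> /=.
  exact: measurable_fst.
exact: measurable_snd.
Qed.

HB.instance Definition _ :=
  isMeasurableFun.Build _ _ _ _ pair_complex measurable_pair_complex.

End complex_measurable.

Section gauss_measure.
Context {R : realType}.

Definition gauss_measure (A : set (measurableTypeR R)) : \bar R :=
  (\int[lebesgue_measure]_(x in A)
     ((Num.sqrt pi)^-1 * expR (- x ^+ 2))%:E)%E.

Lemma gauss_measureE :
  gauss_measure = normal_prob (0 : R) (Num.sqrt (2^-1 : R)).
Proof.
apply/funext => A; rewrite /gauss_measure /normal_prob.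
apply: eq_integral => x _; congr EFin.
have h : (Num.sqrt 2^-1 : R) ^+ 2 = 2^-1 by rewrite sqr_sqrtr.
have h0 : (Num.sqrt 2^-1 : R) != 0 by rewrite gt_eqF// sqrtr_gt0.
rewrite normal_pdfE// /normal_peak /normal_fun h subr0.
have -> : 2^-1 *+ 2 = 1 :> R by field.
have -> : 2^-1 * pi *+ 2 = pi :> R by field.
by rewrite divr1.
Qed.

Let gauss0 : gauss_measure set0 = 0%E.
Proof. by rewrite gauss_measureE measure0. Qed.

Let gauss_ge0 A : (0 <= gauss_measure A)%E.
Proof. by rewrite gauss_measureE. Qed.

Let gauss_sigma_additive : semi_sigma_additive gauss_measure.
Proof. by rewrite gauss_measureE; exact: measure_semi_sigma_additive. Qed.

HB.instance Definition _ := isMeasure.Build _ _ _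
  gauss_measure gauss0 gauss_ge0 gauss_sigma_additive.

Let gauss_setT : gauss_measure setT = 1%E.
Proof. by rewrite gauss_measureE probability_setT. Qed.

HB.instance Definition _ :=
  Measure_isProbability.Build _ _ _ gauss_measure gauss_setT.

Definition gauss_complex : set R[i] -> \bar R :=
  distribution (gauss_measure \x gauss_measure)%E pair_complex.

HB.instance Definition _ := Probability.on gauss_complex.

End gauss_measure.

Section complex_measurable_functions.
Context {R : realType} d (T : measurableType d).
Implicit Types f g : T -> R[i].

Lemma measurable_cfunD f g : measurable_fun setT f -> measurable_fun setT g ->
  measurable_fun setT (f \+ g).
Proof.
move=> /measurable_fun_complexP[f1 f2] /measurable_fun_complexP[g1 g2].
apply/measurable_fun_complexP; split.
  rewrite (_ : (fun _ => _) = (fun x => complex.Re (f x) + complex.Re (g x))).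
    exact: measurable_funD.
  by apply/funext => x /=; case: (f x) => a b; case: (g x).
rewrite (_ : (fun _ => _) = (fun x => complex.Im (f x) + complex.Im (g x))).
  exact: measurable_funD.
by apply/funext => x /=; case: (f x) => a b; case: (g x).
Qed.

Lemma measurable_cfunZ (a : R[i]) f : measurable_fun setT f ->
  measurable_fun setT (a \*o f).
Proof.
move=> /measurable_fun_complexP[f1 f2].
apply/measurable_fun_complexP; split.
  rewrite (_ : (fun _ => _) = (fun x => complex.Re a * complex.Re (f x) -
      complex.Im a * complex.Im (f x))).
    by apply: measurable_funB; apply: measurable_funM.
  by apply/funext => x /=; case: (f x) => u v; case: (a).
rewrite (_ : (fun _ => _) = (fun x => complex.Re a * complex.Im (f x) +
    complex.Im a * complex.Re (f x))).
  by apply: measurable_funD; apply: measurable_funM.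
by apply/funext => x /=; case: (f x) => u v; case: (a).
Qed.

Lemma measurable_cindic (A : set T) : measurable A ->
  measurable_fun setT (fun x => (\1_A x)%:C : R[i]).
Proof.
move=> mA; apply/measurable_fun_complexP; split => //=.
exact: measurable_indic.
Qed.

Lemma measurable_norm_ge f (e : R) : measurable_fun setT f ->
  measurable [set x | e%:C <= `|f x|].
Proof.
move=> /measurable_fun_complexP[f1 f2].
rewrite (_ : [set _ | _] = setT `&` (fun x => Num.sqrt (complex.Re (f x) ^+ 2 +
    complex.Im (f x) ^+ 2)) @^-1` `[e, +oo[); last first.
  rewrite setTI; apply/seteqP; split => x /=;
    by rewrite in_itv/= andbT normc_def lecR.
have : measurable_fun setT (fun x => Num.sqrt (complex.Re (f x) ^+ 2 +
    complex.Im (f x) ^+ 2)).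
  apply: (@measurableT_comp _ _ _ _ _ _ (@Num.sqrt R)).
    by apply: continuous_measurable_fun; exact: sqrt_continuous.
  by apply: measurable_funD; apply: measurable_funX.
by apply => //; exact: measurable_itv.
Qed.

End complex_measurable_functions.

Section L0.
Context d (T : measurableType d) (R : realType).
Variable mu : {finite_measure set T -> \bar R}.

Definition L0 : Type := {mfun_ mu, T >-> R[i]}.

HB.instance Definition _ := EqQuotient.on L0.
HB.instance Definition _ := Choice.on L0.

(* An element of L0 is used as a function through a chosen representative; it
   only enters the definitions up to mu-null sets. *)
Definition L0_fun (u : L0) : T -> R[i] := repr u.
Coercion L0_fun : L0 >-> Funclass.

Definition L0_class (f : T -> R[i]) (mf : measurable_fun setT f) : L0 :=
  \pi_L0 (mfun_Sub (mem_set mf)).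

Lemma L0_measurable (u : L0) : measurable_fun setT u.
Proof. exact: (@measurable_funPT _ _ _ _ (repr u)). Qed.
Hint Resolve L0_measurable : core.

Lemma L0_classE (f : T -> R[i]) (mf : measurable_fun setT f) :
  \forall x \ae mu, L0_class mf x = f x.
Proof.
have /eqP := reprK (L0_class mf).
by rewrite eqmodE => /asboolP; apply: filterS => x /(_ Logic.I).
Qed.

Lemma L0_eqP (u v : L0) : (\forall x \ae mu, u x = v x) -> u = v.
Proof.
move=> uv; rewrite -[u]reprK -[v]reprK; apply/eqP; rewrite eqmodE.
by apply/asboolP; apply: filterS uv.
Qed.

Definition L0_zero : L0 := L0_class (measurable_cst (0 : R[i])).

Definition L0_add (u v : L0) : L0 :=
  L0_class (measurable_cfunD (L0_measurable u) (L0_measurable v)).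

Definition L0_scale (a : R[i]) (u : L0) : L0 :=
  L0_class (measurable_cfunZ a (L0_measurable u)).

Definition L0_opp (u : L0) : L0 := L0_scale (-1) u.

Let L0_zeroP : \forall x \ae mu, L0_zero x = 0.
Proof. exact: L0_classE. Qed.

Let L0_addP (u v : L0) : \forall x \ae mu, L0_add u v x = u x + v x.
Proof. exact: L0_classE. Qed.

Let L0_scaleP a (u : L0) : \forall x \ae mu, L0_scale a u x = a * u x.
Proof. exact: L0_classE. Qed.

Let L0_addA : associative L0_add.
Proof.
move=> u v w; apply: L0_eqP; near=> x.
rewrite (near (L0_addP u (L0_add v w)) x)// (near (L0_addP v w) x)//.
by rewrite (near (L0_addP (L0_add u v) w) x)// (near (L0_addP u v) x)// addrA.
Unshelve. all: by end_near. Qed.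

Let L0_addC : commutative L0_add.
Proof.
move=> u v; apply: L0_eqP; near=> x.
by rewrite (near (L0_addP u v) x)// (near (L0_addP v u) x)// addrC.
Unshelve. all: by end_near. Qed.

Let L0_add0 : left_id L0_zero L0_add.
Proof.
move=> u; apply: L0_eqP; near=> x.
by rewrite (near (L0_addP L0_zero u) x)// (near L0_zeroP x)// add0r.
Unshelve. all: by end_near. Qed.

Let L0_addN : left_inverse L0_zero L0_opp L0_add.
Proof.
move=> u; apply: L0_eqP; near=> x.
rewrite (near (L0_addP (L0_opp u) u) x)// (near L0_zeroP x)//.
by rewrite (near (L0_scaleP (-1) u) x)// mulN1r addNr.
Unshelve. all: by end_near. Qed.

HB.instance Definition _ :=
  GRing.isZmodule.Build L0 L0_addA L0_addC L0_add0 L0_addN.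

Let L0_scaleA a b u : L0_scale a (L0_scale b u) = L0_scale (a * b) u.
Proof.
apply: L0_eqP; near=> x.
rewrite (near (L0_scaleP a (L0_scale b u)) x)// (near (L0_scaleP b u) x)//.
by rewrite (near (L0_scaleP (a * b) u) x)// mulrA.
Unshelve. all: by end_near. Qed.

Let L0_scale1 : left_id 1 L0_scale.
Proof.
move=> u; apply: L0_eqP; near=> x.
by rewrite (near (L0_scaleP 1 u) x)// mul1r.
Unshelve. all: by end_near. Qed.

Let L0_scaleDr : right_distributive L0_scale +%R.
Proof.
move=> a u v; apply: L0_eqP; near=> x.
rewrite (near (L0_scaleP a (u + v)) x)// (near (L0_addP u v) x)//.
rewrite (near (L0_addP (L0_scale a u) (L0_scale a v)) x)//.
by rewrite (near (L0_scaleP a u) x)// (near (L0_scaleP a v) x)// mulrDr.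
Unshelve. all: by end_near. Qed.

Let L0_scaleDl u : {morph L0_scale^~ u : a b / a + b}.
Proof.
move=> a b; apply: L0_eqP; near=> x.
rewrite (near (L0_scaleP (a + b) u) x)//.
rewrite (near (L0_addP (L0_scale a u) (L0_scale b u)) x)//.
by rewrite (near (L0_scaleP a u) x)// (near (L0_scaleP b u) x)// mulrDl.
Unshelve. all: by end_near. Qed.

HB.instance Definition _ := GRing.Zmodule_isLmodule.Build R[i] L0
  L0_scaleA L0_scale1 L0_scaleDr L0_scaleDl.

Lemma L0_0E : \forall x \ae mu, (0 : L0) x = 0.
Proof. exact: L0_zeroP. Qed.

Lemma L0_DE (u v : L0) : \forall x \ae mu, (u + v : L0) x = u x + v x.
Proof. exact: L0_addP. Qed.

Lemma L0_ZE a (u : L0) : \forall x \ae mu, (a *: u : L0) x = a * u x.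
Proof. exact: L0_scaleP. Qed.

(* k.+1 ranges over the positive integers. *)
Definition L0_ball (k : nat) : set L0 :=
  [set g | (mu [set x | k.+1%:R^-1 <= `|g x|]%R < (k.+1%:R^-1)%:E)%E].

Let W (e : R) : set L0 := [set g | (mu [set x | e%:C <= `|g x|]%R < e%:E)%E].

Let L0_ballE k : L0_ball k = W k.+1%:R^-1.
Proof.
rewrite /L0_ball /W; apply/funext => g /=; congr (mu _ < _)%E.
by apply/funext => x /=; rewrite fmorphV/= rmorph_nat.
Qed.

Let mW (u : L0) e : measurable [set x | e%:C <= `|u x|].
Proof. exact: measurable_norm_ge. Qed.

Let ae_le (A B : set T) : measurable A -> measurable B ->
  (\forall x \ae mu, A x -> B x) -> (mu A <= mu B)%E.
Proof.
move=> mA mB [N [mN N0 AB]].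
apply: (@le_trans _ _ (mu (B `|` N))).
  apply: le_measure; rewrite ?inE//; first exact: measurableU.
  move=> x Ax; have [Bx|Bx] := pselect (B x); first by left.
  by right; apply: AB => /= /(_ Ax).
rewrite (le_trans (measureU2 _ _ _))//.
by rewrite [X in (_ + X)%E]N0 adde0.
Qed.

Let W_le e e' : e <= e' -> W e `<=` W e'.
Proof.
move=> ee' u; rewrite /W /= => ue; apply: lt_le_trans (_ : e%:E <= _)%E; last first.
  by rewrite lee_fin.
apply: le_lt_trans ue; apply: le_measure; rewrite ?inE//.
by move=> x /=; apply: le_trans; rewrite lecR.
Qed.

Let W0 e : 0 < e -> W e 0.
Proof.
move=> e0; rewrite /W /=; apply: (@le_lt_trans _ _ (mu set0)); last first.
  by rewrite measure0 lte_fin.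
apply: ae_le => //; near=> x; rewrite /= (near L0_0E x)// normr0.
by rewrite lecR leNgt e0.
Unshelve. all: by end_near. Qed.

Let W_cover e (u : L0) (A B : set T) : measurable A -> measurable B ->
  (mu A < (e / 2)%:E)%E -> (mu B < (e / 2)%:E)%E ->
  (\forall x \ae mu, e%:C <= `|u x| -> A x \/ B x) -> W e u.
Proof.
move=> mA mB Ae Be uAB; rewrite /W /=.
apply: (@le_lt_trans _ _ (mu (A `|` B))).
  by apply: ae_le => //; exact: measurableU.
by rewrite (le_lt_trans (measureU2 _ _ _))// [e in ltRHS]splitr EFinD lteD.
Qed.

Let normc_split (e : R) (a b c : R[i]) : a = b + c ->
  e%:C <= `|a| -> (e / 2)%:C <= `|b| \/ (e / 2)%:C <= `|c|.
Proof.
move=> -> eab; have := le_trans eab (ler_normD b c).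
rewrite (normc_def b) (normc_def c) -rmorphD/= !lecR => h.
apply/orP; rewrite -[_ || _]negbK negb_or -!ltNge; apply/negP => /andP[h1 h2].
by move: h; rewrite leNgt [e]splitr ltrD.
Qed.

Let WD e (u v : L0) : W (e / 2) u -> W (e / 2) v -> W e (u + v).
Proof.
move=> ue ve; apply: (W_cover _ _ ue ve) => //; near=> x.
by apply: normc_split; rewrite (near (L0_DE u v) x).
Unshelve. all: by end_near. Qed.

Let W_ZN1 e (u : L0) : W e u -> W e (- u).
Proof.
move=> ue; apply: le_lt_trans ue; apply: ae_le => //; near=> x => /=.
rewrite (_ : (- u : L0) x = - u x) ?normrN//.
by rewrite -mulN1r -(near (L0_ZE (-1) u) x)// scaleN1r.
Unshelve. all: by end_near. Qed.

Let invS_cvg (e : R) : 0 < e -> exists k : nat, k.+1%:R^-1 <= e.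
Proof.
move=> e0; exists (Num.truncn e^-1).
rewrite invf_ple ?posrE// ltW//; exact: truncnS_gt.
Qed.

Let ball_half k : exists n, L0_ball n `<=` W ((k.+1%:R^-1) / 2).
Proof.
have [|n nk] := @invS_cvg (k.+1%:R^-1 / 2); first exact: divr_gt0.
by exists n; rewrite L0_ballE; exact: W_le.
Qed.

Let ball_leq k n : (k <= n)%N -> L0_ball n `<=` L0_ball k.
Proof.
move=> kn; rewrite !L0_ballE; apply: W_le.
by rewrite lef_pV2 ?posrE// ler_nat.
Qed.

(* The translates of the zero-neighbourhoods L0_ball k are a neighbourhood
   basis. *)
Let L0_nbhs (u : L0) : set_system L0 :=
  filter_from setT (fun k => [set v | L0_ball k (v - u)]).

HB.instance Definition _ := hasNbhs.Build L0 L0_nbhs.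

Let L0_nbhs_filter (u : L0) : ProperFilter (nbhs u).
Proof.
apply: filter_from_proper; last first.
  by move=> k _; exists u => /=; rewrite subrr L0_ballE; exact: W0.
apply: filter_from_filter; first by exists 0%N.
move=> i j _ _; exists (maxn i j) => // v /= vu.
by split; apply: ball_leq vu; rewrite ?leq_maxl ?leq_maxr.
Qed.

Let L0_nbhs_singleton (u : L0) (A : set L0) : nbhs u A -> A u.
Proof. by case=> k _; apply => /=; rewrite subrr L0_ballE; exact: W0. Qed.

Let L0_nbhs_nbhs (u : L0) (A : set L0) : nbhs u A -> nbhs u (nbhs^~ A).
Proof.
case=> k _ kA; have [n nk] := ball_half k; exists n => // v /= vu.
exists n => // w /= wv; apply: kA => /=.
by rewrite L0_ballE -(subrKA v); apply: WD; apply: nk.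
Qed.

HB.instance Definition _ := Nbhs_isNbhsTopological.Build L0
  L0_nbhs_filter L0_nbhs_singleton L0_nbhs_nbhs.

Lemma L0_nbhsE (u : L0) :
  nbhs u = filter_from setT (fun k => [set v | L0_ball k (v - u)]).
Proof. by []. Qed.

Let L0_add_continuous : continuous (fun x : L0 * L0 => x.1 + x.2).
Proof.
move=> [u v] A [k _ kA]; have [n nk] := ball_half k.
exists ([set w | L0_ball n (w - u)], [set w | L0_ball n (w - v)]).
  by split; exists n.
move=> [u' v'] /= [uu' vv']; apply: kA => /=.
by rewrite L0_ballE opprD addrACA; apply: WD; apply: nk.
Qed.

Let W_scale e a (u : L0) (r : R) : 0 < r -> `|a| <= r%:C ->
  0 < e -> W (e / Num.max r 1) u -> W e (a *: u).
Proof.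
move=> r0 ar e0 ue.
have m0 : 0 < Num.max r 1 by rewrite lt_max r0.
apply: (@lt_le_trans _ _ (e / Num.max r 1)%:E); last first.
  rewrite lee_fin ler_pdivrMr// ler_peMr//; first exact: ltW.
  by rewrite le_max lexx orbT.
apply: le_lt_trans ue; apply: ae_le => //; near=> x => /=.
rewrite (near (L0_ZE a u) x)// normrM => eau.
have {eau} : e%:C <= (Num.max r 1)%:C * `|u x|.
  rewrite (le_trans eau)// ler_wpM2r// (le_trans ar)// lecR.
  by rewrite le_max lexx.
by rewrite (normc_def (u x)) -rmorphM/= !lecR ler_pdivrMr// mulrC.
Unshelve. all: by end_near. Qed.

Let tail_cvg (u : L0) (e : R) : 0 < e ->
  exists n : nat, (mu [set x | n%:R%:C <= `|u x|]%R < e%:E)%E.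
Proof.
move=> e0; pose F n := [set x | (n%:R : R)%:C <= `|u x|].
have F0 : \bigcap_n F n = set0.
  apply/seteqP; split => // x /= Fx.
  pose r := complex.Re `|u x|.
  have ur : `|u x| = r%:C by rewrite /r normc_def.
  have := Fx (Num.truncn r).+1 Logic.I.
  by rewrite /F /= ur lecR leNgt truncnS_gt.
have : mu \o F @ \oo --> mu (\bigcap_n F n).
  apply: nonincreasing_cvg_mu => //.
  - by rewrite (le_lt_trans _ (fin_num_fun_lty (fin_num_measure mu)))//
      le_measure ?inE//; exact: mW.
  - by move=> n; exact: mW.
  - by rewrite F0.
  - move=> m n mn; apply/subsetPset => x; apply: le_trans.
    by rewrite lecR ler_nat.
rewrite F0 measure0 => Fc.
have : \forall n \near \oo, ((mu \o F) n < e%:E)%E.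
  by apply: (Fc [set y | (y < e%:E)%E]); apply: open_ereal_lt'; rewrite lte_fin.
by move=> [n _ /(_ n (leqnn n))] /= ?; exists n.
Qed.

Let L0_scale_continuous : continuous (fun z : R[i]^o * L0 => z.1 *: z.2).
Proof.
move=> [a u] A [k _ kA]; set e : R := k.+1%:R^-1.
have e0 : 0 < e by rewrite invr_gt0.
have e20 : 0 < e / 2 by rewrite divr_gt0.
have [n un] := tail_cvg u e20.
pose r := complex.Re `|a| + 1.
have r0 : 0 < r by rewrite ltr_wpDl// normc_def/= sqrtr_ge0.
have [|m me] := @invS_cvg (e / 2 / Num.max r 1).
  by rewrite divr_gt0// lt_max r0.
pose del : R := Num.min 1 (e / 2 / n.+1%:R).
have del0 : 0 < del by rewrite lt_min ltr01 divr_gt0.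
exists (ball (a : R[i]^o) del%:C, [set w | L0_ball m (w - u)]).
  split; last by exists m.
  by apply: nbhsx_ballx; rewrite ltcR.
move=> [b v] /= [ab uv]; apply: kA => /=; rewrite L0_ballE -/e.
rewrite -ball_normE/= distrC in ab.
rewrite (_ : b *: v - a *: u = (b - a) *: u + b *: (v - u)); last first.
  by rewrite scalerBl scalerBr [RHS]addrC addrA subrK.
have mA := @mW u n%:R.
have Wb : W (e / 2) (b *: (v - u)).
  apply: (W_scale r0) => //; last by apply: (W_le me); rewrite -L0_ballE.
  have ra : `|a| = (complex.Re `|a|)%:C by rewrite normc_def.
  rewrite /r rmorphD/= -ra -lerBlDl (le_trans (lerB_dist _ _))//.
  by rewrite (le_trans (ltW ab))// lecR ge_min lexx.
apply: (W_cover mA (mW (b *: (v - u)) (e / 2)) un Wb); near=> x => eab.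
have xE := near (L0_DE ((b - a) *: u) (b *: (v - u))) x.
have {xE} [//|h|h] := normc_split (xE _) eab; last by right.
left; move: h => /=; rewrite (near (L0_ZE (b - a) u) x)// normrM => h.
have {h} : (e / 2)%:C <= (e / 2 / n.+1%:R)%:C * `|(u : L0) x|.
  rewrite (le_trans h)// ler_wpM2r// (le_trans (ltW ab))// lecR.
  by rewrite ge_min lexx orbT.
rewrite (normc_def ((u : L0) x)) -rmorphM/= !lecR mulrAC ler_pdivlMr// ler_pM2l//.
by apply: le_trans; rewrite ler_nat.
Unshelve. all: by end_near. Qed.

HB.instance Definition _ :=
  PreTopologicalNmodule_isTopologicalNmodule.Build L0 L0_add_continuous.
HB.instance Definition _ :=
  TopologicalNmodule_isTopologicalLmodule.Build R[i] L0 L0_scale_continuous.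

Lemma L0_hausdorff : hausdorff_space L0.
Proof.
move=> u v uv; suff uvW k : L0_ball k (u - v).
  apply: L0_eqP.
  have N0 k : mu [set x | (k.+1%:R^-1 : R)%:C <= `|(u - v : L0) x|] = 0.
    apply/eqP; rewrite eq_le measure_ge0 andbT; apply/lee_addgt0Pr => e e0.
    have [n ne] := invS_cvg e0; rewrite add0e.
    apply: (@le_trans _ _ ((maxn k n).+1%:R^-1%:E)); last first.
      rewrite lee_fin (le_trans _ ne)// lef_pV2 ?posrE// ler_nat ltnS.
      exact: leq_maxr.
    have := uvW (maxn k n); rewrite L0_ballE => /ltW; apply: le_trans.
    apply: le_measure; rewrite ?inE//.
    move=> x /=; apply: le_trans; rewrite lecR lef_pV2 ?posrE// ler_nat ltnS.
    exact: leq_maxl.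
  have N x : (u - v : L0) x <> 0 ->
      (\bigcup_k [set x | (k.+1%:R^-1 : R)%:C <= `|(u - v : L0) x|]) x.
    move=> /eqP; rewrite -normr_gt0 normc_def ltcR => /invS_cvg[k kx].
    by exists k => //=; rewrite normc_def lecR.
  have : \forall x \ae mu, (u - v : L0) x = 0.
    exists (\bigcup_k [set x | (k.+1%:R^-1 : R)%:C <= `|(u - v : L0) x|]); split.
    - by apply: bigcup_measurable => k _; exact: mW.
    - apply/eqP; rewrite eq_le measure_ge0 andbT.
      have mF k : measurable [set x | (k.+1%:R^-1 : R)%:C <= `|(u - v : L0) x|].
        exact: mW.
      have mUF := bigcup_measurable (fun k (_ : [set: nat] k) => mF k).
      have H := measure_sigma_subadditive mu mF mUF (@subset_refl _ _).
      apply: (le_trans H).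
      by rewrite eseries0 // => k _ _; exact: N0.
    - by move=> x /= /N.
  move=> uv0; near=> x; apply/eqP; rewrite -subr_eq0; apply/eqP.
  rewrite -(near uv0 x)// (near (L0_DE u (- v)) x)//.
  by rewrite -scaleN1r (near (L0_ZE (-1) v) x)// mulN1r.
have [n nk] := ball_half k.
have [||w [/= wu wv]] := uv [set w | L0_ball n (w - u)] [set w | L0_ball n (w - v)].
- by exists n.
- by exists n.
rewrite L0_ballE -(subrKA w); apply: WD; last exact: nk.
by rewrite -opprB; apply: W_ZN1; exact: nk.
Unshelve. all: by end_near. Qed.

End L0.

Section differentiability.
Context {K : numFieldType} {E : topologicalLmodType K}.

Definition rV_in (U : set K) (n : nat) : set 'rV[K]_n :=
  [set x | forall i, U (x 0 i)].

(* divdiff U f k g states that f is of class C^k on U with g = f^{<k>} on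
   U^{k+1}. For x = (x_1, x_2, ..., x_n), col' 1 x and col' 0 x are
   (x_1, x_3, ..., x_n) and (x_2, x_3, ..., x_n). Outside U^{k+1}, g is
   unconstrained. *)
Fixpoint divdiff (U : set K) (f : K -> E) (k : nat) :
    ('rV[K]_k.+1 -> E) -> Prop :=
  match k with
  | 0 => fun g =>
      {within U, continuous f} /\ forall x, rV_in U x -> g x = f (x 0 0)
  | k'.+1 => fun g =>
      exists2 h : 'rV[K]_k'.+1 -> E, divdiff U f h &
        {within @rV_in U k'.+2, continuous g} /\
        forall x, rV_in U x -> x 0 0 != x 0 1 ->
          g x = (x 0 0 - x 0 1)^-1 *: (h (col' 1 x) - h (col' 0 x))
  end.

Definition is_Ck (U : set K) (k : nat) (f : K -> E) : Prop :=
  exists g, divdiff U f (k := k) g.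

Definition is_Cinfty (U : set K) (f : K -> E) : Prop :=
  forall k, is_Ck U k f.

Definition is_deriv (f g : K -> E) : Prop :=
  forall x, t^-1 *: (f (x + t) - f x) @[t --> 0^'] --> g x.

(* g is the j-th iterated derivative of f, all intermediate limits existing;
   in a Hausdorff space such a g is unique. *)
Fixpoint is_derivn (j : nat) (f g : K -> E) : Prop :=
  if j is j'.+1 then exists2 h, is_derivn j' f h & is_deriv h g else f = g.

End differentiability.

Section quadrant.
Context {R : realType}.

Definition quadrant (z : R[i]) : set R[i] :=
  [set w | complex.Re w <= complex.Re z /\ complex.Im w <= complex.Im z].

Lemma measurable_quadrant (z : R[i]) : measurable (quadrant z).
Proof.
exists (`]-oo, complex.Re z] `*` `]-oo, complex.Im z]).
  by apply: measurableX; exact: measurable_itv.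
by rewrite setTI; apply/seteqP; split => w /=; rewrite !in_itv.
Qed.

Definition quadrant_indic (z : R[i]) : L0 (@gauss_complex R) :=
  L0_class _ (measurable_cindic (R := R) (measurable_quadrant z)).

End quadrant.

(* Main.v *)
Require Import Defs.
From HB Require Import structures.
From mathcomp Require Import all_boot all_order all_algebra.
From mathcomp Require Import all_classical all_reals all_analysis.
From mathcomp Require Import measurable_realfun.
From mathcomp Require Import complex ring.

Set Implicit Arguments.
Unset Strict Implicit.
Unset Printing Implicit Defensive.

Import Order.TTheory GRing.Theory Num.Theory.
Import numFieldNormedType.Exports.

Local Open Scope classical_set_scope.
Local Open Scope ring_scope.
Local Open Scope complex_scope.

(* For fixed w, the function z |-> 1_{A(z)}(w) is locally constant off two
   half-lines, so its divided difference at nodes x_1, ..., x_n, repetitions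
   allowed, only depends on the nodes and on the bits b_i = [w in A(x_i)]: it is
   the leading coefficient of a Hermite interpolation polynomial, and it is
   continuous in the nodes as long as nodes with distinct bits stay distinct.
   When x moves a little, the bits change only for w in a set of small measure,
   and whatever happens there is irrelevant to convergence in measure. Hence
   the class of w |-> [x_1, ..., x_n] 1_{A(.)}(w) is continuous in x. For the
   same reason all difference quotients of f tend to 0, whereas f is injective
   because the Gauss measure charges every rectangle. *)

(** * Hermite interpolation of 0-1 data and its divided differences *)

Section interpolation.
Context {K : fieldType}.

Definition nodal_poly {n : nat} (P : pred 'I_n) (x : 'rV[K]_n) : {poly K} :=
  \prod_(i < n | P i) ('X - (x 0 i)%:P).

Definition separating {n : nat} (b : 'I_n -> bool) (x : 'rV[K]_n) : Prop :=
  forall i j, b i -> ~~ b j -> x 0 i != x 0 j.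

(** Hermite conditions stated as divisibility, so that repeated nodes count with their multiplicity:
    [H] agrees with 1 at the nodes with bit true and with 0 at the others. *)
Definition interpolant {n : nat} (b : 'I_n -> bool) (x : 'rV[K]_n)
    (H : {poly K}) : Prop :=
  [/\ (size H <= n)%N, nodal_poly b x %| H - 1 &
      nodal_poly (fun i => ~~ b i) x %| H].

Lemma separating_lift {n : nat} (b : 'I_n.+1 -> bool) (x : 'rV[K]_n.+1) i :
  separating b x -> separating (b \o lift i) (col' i x).
Proof. by move=> bx j k bj bk; rewrite !mxE; exact: bx. Qed.

Lemma coprimep_nodal_poly {n : nat} (b : 'I_n -> bool) (x : 'rV[K]_n) :
  separating b x ->
  coprimep (nodal_poly b x) (nodal_poly (fun i => ~~ b i) x).
Proof.
move=> bx; rewrite /nodal_poly.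
apply: (big_ind (fun p => coprimep p _)) => [|p q cp cq|i bi].
- exact: coprime1p.
- by rewrite coprimepMl cp.
apply: (big_ind (fun p => coprimep _ p)) => [|p q cp cq|j bj].
- exact: coprimep1.
- by rewrite coprimepMr cp.
by rewrite coprimep_XsubC root_XsubC eq_sym bx.
Qed.

Lemma monic_nodal_poly {n : nat} (P : pred 'I_n) (x : 'rV[K]_n) :
  nodal_poly P x \is monic.
Proof. by apply: monic_prod => i _; exact: monicXsubC. Qed.

Lemma size_nodal_polyM {n : nat} (b : 'I_n -> bool) (x : 'rV[K]_n) :
  size (nodal_poly b x * nodal_poly (fun i => ~~ b i) x) = n.+1.
Proof.
rewrite /nodal_poly -(bigID b predT) /= size_prod_XsubC.
by rewrite -[RHS](congr1 succn (size_enum_ord n)) enumT.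
Qed.

(** [G - H] is divisible by the product of the two coprime nodal polynomials, which has size [n.+1],
    but its own size is at most [n]. *)
Lemma interpolant_uniq {n : nat} (b : 'I_n -> bool) (x : 'rV[K]_n) G H :
  separating b x -> interpolant b x G -> interpolant b x H -> G = H.
Proof.
move=> bx [sG G1 G0] [sH H1 H0]; apply/eqP; rewrite -subr_eq0.
apply: contraT => GH.
have /dvdp_leq : nodal_poly b x * nodal_poly (fun i => ~~ b i) x %| G - H.
  rewrite Gauss_dvdp ?coprimep_nodal_poly//; apply/andP; split.
    have -> : G - H = (G - 1) - (H - 1) by rewrite opprB addrA subrK.
    exact: dvdp_sub.
  exact: dvdp_sub.
move=> /(_ GH); rewrite size_nodal_polyM.
move=> /leq_trans/(_ (size_polyD _ _)).
by rewrite size_polyN ltnNge geq_max sG sH.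
Qed.

(** Chinese remainders: if [u * P + v * Q = 1], then [v * Q] is 1 modulo [P] and 0 modulo [Q];
    reduction modulo [P * Q] brings the size down to at most [n]. *)
Lemma interpolant_exists {n : nat} (b : 'I_n -> bool) (x : 'rV[K]_n) :
  separating b x -> exists H, interpolant b x H.
Proof.
move=> bx; set P := nodal_poly b x; set Q := nodal_poly (fun i => ~~ b i) x.
have /Bezout_eq1_coprimepP[[u v] /= uv] := coprimep_nodal_poly bx.
have PQ0 : P * Q != 0 by rewrite monic_neq0// monicMr monic_nodal_poly.
have vE : v * Q %/ (P * Q) * (P * Q) + v * Q %% (P * Q) = v * Q.
  by rewrite -divp_eq.
have mE : v * Q %% (P * Q) = v * Q - v * Q %/ (P * Q) * (P * Q).
  by apply/eqP; rewrite eq_sym subr_eq addrC vE.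
exists (v * Q %% (P * Q)); split.
- by rewrite -ltnS -(size_nodal_polyM b x) ltn_modp.
- rewrite mE (_ : _ - 1 = - (u + v * Q %/ (P * Q) * Q) * P) ?dvdp_mull//.
  rewrite -uv -/P -/Q; ring.
- by rewrite mE mulrA -mulrBl dvdp_mull.
Qed.

(** Aitken-Neville step: the factor ['X - x_k] restores the node omitted by [col' k], and the two
    weights, divided by [x_i - x_j], add up to 1. *)
Lemma interpolant_Neville {n : nat} (b : 'I_n.+1 -> bool) (x : 'rV[K]_n.+1)
    i j Hi Hj : x 0 i != x 0 j ->
  interpolant (b \o lift i) (col' i x) Hi ->
  interpolant (b \o lift j) (col' j x) Hj ->
  interpolant b x ((x 0 i - x 0 j)^-1 *:
    (('X - (x 0 j)%:P) * Hj - ('X - (x 0 i)%:P) * Hi)).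
Proof.
move=> xij [si i1 i0] [sj j1 j0].
have nodal_lift (P : pred 'I_n.+1) k G :
    nodal_poly (P \o lift k) (col' k x) %| G ->
    nodal_poly P x %| ('X - (x 0 k)%:P) * G.
  have E : \prod_(i < n | P (lift k i)) ('X - (x 0 (lift k i))%:P) =
      nodal_poly (P \o lift k) (col' k x).
    by apply: eq_bigr => l _; rewrite mxE.
  move=> PG; have [Pk|Pk] := boolP (P k).
    by rewrite /nodal_poly (bigD1_ord k)//= E dvdp_mul.
  rewrite /nodal_poly.
  suff -> : \prod_(i < n.+1 | P i) ('X - (x 0 i)%:P) =
      \prod_(i < n | P (lift k i)) ('X - (x 0 (lift k i))%:P).
    by rewrite E dvdp_mull.
  rewrite big_mkcond (bigD1_ord k)//= (negbTE Pk) mul1r.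
  by rewrite -big_mkcond.
have sXM k (G : {poly K}) : (size G <= n)%N ->
    (size (('X - (x 0 k)%:P) * G)%R <= n.+1)%N.
  move=> sG; rewrite (leq_trans (size_polyMleq _ _))// size_XsubC.
  by rewrite addSn addSn add0n.
have d0 : x 0 i - x 0 j != 0 by rewrite subr_eq0.
split.
- rewrite (leq_trans (size_scale_leq _ _))// (leq_trans (size_polyD _ _))//.
  by rewrite size_polyN geq_max !sXM.
- have -> : (x 0 i - x 0 j)^-1 *:
       (('X - (x 0 j)%:P) * Hj - ('X - (x 0 i)%:P) * Hi) - 1 =
     (x 0 i - x 0 j)^-1 *: (('X - (x 0 j)%:P) * (Hj - 1) -
       ('X - (x 0 i)%:P) * (Hi - 1)).
    rewrite -[X in _ - X](scalerK d0) -scalerBr; congr (_ *: _).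
    rewrite -[X in _ - X]mulr1 -mul_polyC polyCB; ring.
  by rewrite dvdpZr ?invr_eq0// dvdp_sub// nodal_lift.
- by rewrite dvdpZr ?invr_eq0// dvdp_sub// nodal_lift.
Qed.

(* The divided difference at the nodes x_i, repetitions allowed, of a function
   with the value b_i near x_i: the leading coefficient of the Hermite
   interpolation polynomial. *)
Definition divdiff_bool {n : nat} (b : 'I_n.+1 -> bool) (x : 'rV[K]_n.+1) : K :=
  (xget 0 (interpolant b x))`_n.

Lemma divdiff_boolE {n : nat} (b : 'I_n.+1 -> bool) (x : 'rV[K]_n.+1) H :
  separating b x -> interpolant b x H -> divdiff_bool b x = H`_n.
Proof.
move=> bx bxH; rewrite /divdiff_bool (xget_unique _ bxH)// => G bxG.
exact: interpolant_uniq bxG bxH.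
Qed.

(** Compares coefficients of index [n.+1] in the Neville formula. The pair of nodes is left free:
    continuity uses two nodes with different bits, the relation defining f^{<k>} the first two. *)
Lemma divdiff_bool_rec {n : nat} (b : 'I_n.+2 -> bool) (x : 'rV[K]_n.+2) i j :
  separating b x -> x 0 i != x 0 j ->
  divdiff_bool b x = (x 0 i - x 0 j)^-1 *
    (divdiff_bool (b \o lift j) (col' j x) -
     divdiff_bool (b \o lift i) (col' i x)).
Proof.
move=> bx xij; have bxi := separating_lift (i := i) bx.
have bxj := separating_lift (i := j) bx.
have [Hi hi] := interpolant_exists bxi.
have [Hj hj] := interpolant_exists bxj.
rewrite (divdiff_boolE bx (interpolant_Neville xij hi hj)).
rewrite (divdiff_boolE bxi hi) (divdiff_boolE bxj hj).
rewrite coefZ; congr (_ * _); rewrite coefB !mulrBl !coefB !coefXM !coefCM/=.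
(* Both interpolants have size at most [n.+1], so their coefficients of index [n.+1] vanish. *)
have [si _ _] := hi; have [sj _ _] := hj.
by rewrite (nth_default _ si) (nth_default _ sj) !mulr0 !subr0.
Qed.

Lemma divdiff_bool_const {n : nat} (c : bool) (x : 'rV[K]_n.+1) :
  divdiff_bool (fun=> c) x = (c && (n == 0%N))%:R.
Proof.
rewrite (@divdiff_boolE _ _ _ c%:R).
- by rewrite -polyC_natr coefC; case: eqP; case: c.
- by move=> i j ->.
- split.
  + by rewrite -polyC_natr (leq_trans (size_polyC_leq1 _)).
  + case: c; first by rewrite subrr dvdp0.
    by rewrite /nodal_poly big_pred0// dvd1p.
  + case: c; last by rewrite dvdp0.
    by rewrite /nodal_poly big_pred0// dvd1p.
Qed.

End interpolation.

(** * Continuity of the divided difference in the nodes, for fixed bits *)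

Section divdiff_bool_continuous.
Context {K : numFieldType}.

Lemma col'_continuous m n (j : 'I_n.+1) :
  continuous (col' j : 'M[K]_(m, n.+1) -> 'M[K]_(m, n)).
Proof.
move=> x A /nbhs_ballP[e /= e0 xA].
have : \forall y \near x, forall k l,
    ball (x k (lift j l)) e ((y : 'M[K]_(m, n.+1)) k (lift j l)).
  apply: (@filter_forall _ _ _ (nbhs x)) => k.
  apply: (@filter_forall _ _ _ (nbhs x)) => l.
  by apply: (@coord_continuous K m n.+1 k (lift j l) x); exact: nbhsx_ballx.
by apply: filterS => y xy; apply: xA; split=> // k l; rewrite !mxE.
Qed.

Lemma coordB_continuous n (i j : 'I_n) :
  continuous (fun y : 'rV[K]_n => y 0 i - y 0 j).
Proof. by move=> x; apply: continuousB; exact: coord_continuous. Qed.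

Lemma separating_near {n : nat} (b : 'I_n -> bool) (x : 'rV[K]_n) :
  separating b x -> \forall y \near x, separating b y.
Proof.
move=> bx.
apply: (@filter_forall _ _ _ (nbhs x)) => i.
apply: (@filter_forall _ _ _ (nbhs x)) => j.
have [bi|bi] := boolP (b i); last exact: (@filterE _ (nbhs x)).
have [bj|bj] := boolP (b j); first exact: (@filterE _ (nbhs x)).
have := @cvgr_neq0 _ _ _ _ (nbhs_filter x) _ _ (@coordB_continuous n i j x).
rewrite subr_eq0 => /(_ (bx _ _ bi bj)).
by apply: filterS => y; rewrite subr_eq0.
Qed.

(** Induction on the number of nodes. Equal bits give a constant; otherwise two nodes with different
    bits stay apart near [x], and the recursion at this pair leads to fewer nodes with a denominator
    bounded away from 0. *)
Lemma divdiff_bool_continuous {n : nat} (b : 'I_n.+1 -> bool)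
    (x : 'rV[K]_n.+1) :
  separating b x -> {for x, continuous (divdiff_bool b : 'rV[K]_n.+1 -> K)}.
Proof.
elim: n b x => [|n IHn] b x bx.
  rewrite (_ : b = fun=> b ord0); last by apply/funext => i; rewrite ord1.
  rewrite (_ : divdiff_bool _ = cst (b ord0)%:R); first exact: cst_continuous.
  by apply/funext => y; rewrite divdiff_bool_const andbT.
have [/forallP bc|] := boolP [forall i, b i == b ord0].
  rewrite (_ : b = fun=> b ord0); last by apply/funext => i; exact/eqP.
  rewrite (_ : divdiff_bool _ = cst 0); first exact: cst_continuous.
  by apply/funext => y; rewrite divdiff_bool_const andbF.
rewrite negb_forall => /existsP[i0 bi0].
have [i [j [bi bj]]] : exists i j, b i /\ ~~ b j.
  move: bi0; case: (boolP (b ord0)) => b0.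
    by rewrite eqb_id => ?; exists ord0, i0.
  by rewrite eqbF_neg negbK => ?; exists i0, ord0.
have xij := bx _ _ bi bj.
pose g (y : 'rV[K]_n.+2) := (y 0 i - y 0 j)^-1 *
    (divdiff_bool (b \o lift j) (col' j y) -
     divdiff_bool (b \o lift i) (col' i y)).
have gE : \forall y \near x, g y = divdiff_bool b y.
  have := separating_near bx; apply: filterS => y byx.
  by rewrite (divdiff_bool_rec byx (byx _ _ bi bj)).
have cK k : {for x, continuous (fun y : 'rV[K]_n.+2 =>
    divdiff_bool (b \o lift k) (col' k y))}.
  apply: (@continuous_comp 'rV[K]_n.+2 'rV[K]_n.+1 K (col' k)
    (divdiff_bool (b \o lift k))).
    exact: col'_continuous.
  by apply: IHn; exact: separating_lift.
have cg : {for x, continuous g}.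
  apply: continuousM; last exact: continuousB.
  apply: continuousV; first by rewrite subr_eq0.
  exact: coordB_continuous.
rewrite /prop_for /continuous_at -(nbhs_singleton gE).
exact: cvg_trans (near_eq_cvg gE) cg.
Qed.

Lemma divdiff_bool_near {n : nat} (b : 'I_n.+1 -> bool) (x : 'rV[K]_n.+1) e :
  separating b x -> 0 < e ->
  \forall y \near x, `|divdiff_bool b y - divdiff_bool b x| < e.
Proof.
move=> bx e0; rewrite /prop_near1.
have /(@cvgrPdistC_lt _ _ _ _ (nbhs_filter x)) := divdiff_bool_continuous bx.
exact.
Qed.

End divdiff_bool_continuous.

(** * Convergence in measure and functions of finitely many memberships *)

Section convergence_in_measure.
Context d (T : measurableType d) (R : realType).
Variable mu : {finite_measure set T -> \bar R}.

Lemma L0_BE (u v : L0 mu) : \forall w \ae mu, (u - v : L0 mu) w = u w - v w.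
Proof.
have := L0_DE u (- v); have := L0_ZE (-1) v.
by apply: filterS2 => w; rewrite scaleN1r mulN1r => <-.
Qed.

(** One [e] bounds both the error and the exceptional set, as in [L0_ball]; on [B], which may vary
    with [y], the values of [g y] are free. *)
Lemma L0_cvg_in_measure (V : Type) (F : set_system V) (FF : Filter F)
    (g : V -> L0 mu) (u : L0 mu) :
  (forall e : R, 0 < e -> \forall y \near F, exists B, [/\ measurable B,
    (mu B < e%:E)%E &
    \forall w \ae mu, ~ B w -> `|g y w - u w| < e%:C]) ->
  g @ F --> u.
Proof.
move=> gu A; rewrite L0_nbhsE => -[k _ kA].
have e0 : 0 < k.+1%:R^-1 :> R by rewrite invr_gt0.
have := gu _ e0; rewrite /= /nbhs/=; apply: filterS => y [B [mB Be gB]].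
apply: kA; rewrite /= /L0_ball/=.
have -> : [set w | k.+1%:R^-1 <= `|(g y - u : L0 mu) w|] =
    [set w | (k.+1%:R^-1)%:C <= `|(g y - u : L0 mu) w|].
  by rewrite fmorphV/= rmorph_nat.
have mS := @measurable_norm_ge R _ _ _ (k.+1%:R^-1) (L0_measurable (g y - u)).
(* Outside the null set [N], both the estimate and the pointwise formula for [g y - u] hold. *)
have [N [mN N0 BN]] := filterI gB (L0_BE (g y) u).
apply: (@le_lt_trans _ _ (mu (B `|` N))).
  apply: le_measure; rewrite ?inE//; first exact: measurableU.
  move=> w /= kw; have [Bw|Bw] := pselect (B w); [by left|right].
  apply: BN => /= -[/(_ Bw) gw guE].
  by move: gw; rewrite -guE => /(le_lt_trans kw); rewrite ltxx.
rewrite (le_lt_trans (measureU2 _ _ _))//.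
by rewrite [X in (_ + X)%E]N0 adde0.
Qed.

End convergence_in_measure.

(** There are finitely many bit patterns, so a preimage is a finite union of finite intersections of
    the [A i] and their complements. *)
Lemma measurable_fun_pattern d (T : measurableType d) (R : realType) (n : nat)
    (A : 'I_n -> set T) (F : ('I_n -> bool) -> R[i]) :
  (forall i, measurable (A i)) ->
  measurable_fun setT (fun w => F (fun i => w \in A i)).
Proof.
move=> mA _ B mB.
rewrite [X in measurable X](_ : _ =
  \bigcup_(b in [set b : {ffun 'I_n -> bool} | B (F b)])
    \bigcap_(i in setT) if b i then A i else ~` A i).
  apply: fin_bigcup_measurable => [|b _]; first exact: finite_finset.
  apply: fin_bigcap_measurable => [|i _]; first exact: finite_finset.
  by case: ifP => _ //; exact: measurableC.
rewrite setTI; apply/seteqP; split => [w /= Bw|w /= [b Bb bw]].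
  exists [ffun i => w \in A i] => [|i _ /=].
    by rewrite /= (_ : fun_of_fin _ = fun i => w \in A i)//; apply/funext => i;
      rewrite ffunE.
  by rewrite ffunE; case: ifPn; rewrite ?notin_setE ?inE.
rewrite (_ : (fun i => w \in A i) = b)//; apply/funext => i.
by have /= := bw i Logic.I; case: (b i) => Aw; [exact: mem_set|exact: memNset].
Qed.

Lemma measure_bigsetU_le d (T : measurableType d) (R : realType)
    (mu : {measure set T -> \bar R}) (I : Type) (r : seq I) (A : I -> set T) :
  (forall i, measurable (A i)) ->
  (mu (\big[setU/set0]_(i <- r) A i) <= \sum_(i <- r) mu (A i))%E.
Proof.
move=> mA; elim: r => [|i r IHr]; first by rewrite !big_nil measure0.
rewrite !big_cons (le_trans (measureU2 _ _ _))//.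
  exact: bigsetU_measurable.
exact: leeD2l.
Qed.

(** * Indicators of sets that vary continuously in measure *)

Section indicator_family.
Context d (T : measurableType d) (R : realType).
Let K : numFieldType := R[i].
Variables (mu : {finite_measure set T -> \bar R}) (A : K -> set T).
Hypothesis mA : forall z, measurable (A z).
Hypothesis A_cvg : forall z (e : R), 0 < e ->
  \forall y \near z, (mu (A z `+` A y) < e%:E)%E.

Let f (z : K) : L0 mu := L0_class mu (measurable_cindic (R := R) (mA z)).

Let mY z y : measurable (A z `+` A y).
Proof. by rewrite setY_def; apply: measurableU; exact: measurableD. Qed.

Let setYN z y w : ~ (A z `+` A y) w -> (w \in A z) = (w \in A y).
Proof.
rewrite setY_def /= => h; apply/idP/idP; rewrite !inE => Aw;
  apply: contrapT => nAw; apply: h; [by left|by right].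
Qed.

(* However large the scalars c y are, c y *: (f y - f z) is supported in a set
   of small measure. *)
Lemma indicator_family_cvg0 (c : K -> K) z :
  c y *: (f y - f z) @[y --> z] --> (0 : L0 mu).
Proof.
apply: (@L0_cvg_in_measure _ _ _ _ _ (nbhs z)) => e e0; have := A_cvg z e0.
apply: filterS => y yz; exists (A z `+` A y); split => //.
near=> w => /setYN yzw.
rewrite (near (L0_0E mu) w)// (near (L0_ZE (c y) (f y - f z)) w)//.
rewrite (near (L0_BE (f y) (f z)) w)//.
rewrite (near (L0_classE mu (measurable_cindic (R := R) (mA y))) w)//.
rewrite (near (L0_classE mu (measurable_cindic (R := R) (mA z))) w)//.
by rewrite !indicE yzw !subrr mulr0 subrr normr0 ltcR.
Unshelve. all: by end_near. Qed.

Lemma indicator_family_continuous : continuous f.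
Proof.
move=> z; rewrite /continuous_at -[in X in _ --> X](add0r (f z)).
rewrite [in X in X @ _](_ : f = fun y => 1 *: (f y - f z) + f z); last first.
  by apply/funext => y; rewrite scale1r subrK.
apply: (@continuous2_cvg _ _ _ _ (nbhs z) _ _ _ (fun u v : L0 mu => u + v)).
- exact: (@add_continuous (L0 mu) (0, f z)).
- exact: (@indicator_family_cvg0 (fun=> 1)).
- exact: cvg_cst.
Qed.

(** The case [c y = (y - z)^-1] of [indicator_family_cvg0], restricted to punctured
    neighbourhoods. *)
Lemma indicator_family_deriv : is_deriv f (fun=> 0).
Proof.
move=> z; apply: cvg_within_filter.
rewrite (_ : (fun t => _) = (fun y => (y - z)^-1 *: (f y - f z)) \o shift z).
  rewrite cvg_comp_shift add0r; exact: indicator_family_cvg0.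
by apply/funext => t /=; rewrite [z + t]addrC addrK.
Qed.

(** The witness [g n] for f^{<n>} takes the divided difference separately for each [w], with the
    bits [w \in A (x 0 i)]. *)
Lemma indicator_family_Cinfty : is_Cinfty setT f.
Proof.
pose pat n (x : 'rV[K]_n.+1) w i := w \in A (x 0 i).
have mg n (x : 'rV[K]_n.+1) :
    measurable_fun setT (fun w => divdiff_bool (pat n x w) x).
  apply: (measurable_fun_pattern (fun b => divdiff_bool b x)) => i.
  exact: mA.
pose g n (x : 'rV[K]_n.+1) : L0 mu := L0_class mu (mg n x).
(* A bit depends only on its node, so nodes with different bits are distinct, whatever [w] is. *)
have patS n (x : 'rV[K]_n.+1) w : separating (pat n x w) x.
  by move=> i j; rewrite /pat => wi wj; apply: contraNneq wj => <-.
have gc n : continuous (g n).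
  move=> x; apply: (@L0_cvg_in_measure _ _ _ _ _ (nbhs x)) => e e0.
  pose B (y : 'rV[K]_n.+1) :=
    \big[setU/set0]_(i < n.+1) (A (x 0 i) `+` A (y 0 i)).
  have mB y : measurable (B y) by exact: bigsetU_measurable.
  have Be : \forall y \near x, (mu (B y) < e%:E)%E.
    (* Each of the [n.+1] symmetric differences gets an equal share of [e / 2]; the halving makes
       the final inequality strict. *)
    have en0 : 0 < e / 2 / n.+1%:R by rewrite !divr_gt0.
    have : \forall y \near x, forall i,
        (mu (A (x 0 i) `+` A ((y : 'rV[K]_n.+1) 0 i))%R <
         (e / 2 / n.+1%:R)%:E)%E.
      apply: (@filter_forall _ _ _ (nbhs x)) => i.
      exact: (@coord_continuous _ _ _ 0 i x _ (A_cvg (x 0 i) en0)).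
    apply: filterS => y xy.
    apply: le_lt_trans (measure_bigsetU_le _ _ _) _ => //.
    apply: (@le_lt_trans _ _ (\sum_(i < n.+1) (e / 2 / n.+1%:R)%:E)%E).
      by apply: lee_sum => i _; exact: ltW (xy i).
    rewrite sumEFin sumr_const card_ord -(mulr_natr (_ / _)).
    rewrite divfK ?pnatr_eq0// lte_fin.
    by rewrite ltr_pdivrMr// ltr_pMr// ltr1n.
  (* As there are finitely many patterns [b], one neighbourhood of [x] serves all of them, hence all
     [w] at once. *)
  have Db (b : {ffun 'I_n.+1 -> bool}) : \forall y \near x,
      separating b x -> `|divdiff_bool b y - divdiff_bool b x| < e%:C.
    have [bx|bx] := pselect (separating b x); last exact: (@filterE _ (nbhs x)).
    have e0C : 0 < e%:C :> K by rewrite ltcR.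
    by have := divdiff_bool_near bx e0C; apply: filterS.
  have De := @filter_forall _ _ _ (nbhs x) (nbhs_filter x) Db.
  apply: (@filterS2 _ _ (nbhs_filter x) _ _ _ _ Be De) => y Bye Dye.
  exists (B y); split => //.
  have := L0_classE mu (mg n x); have := L0_classE mu (mg n y).
  apply: filterS2 => w -> -> Bw.
  (* Off [B y] no membership changes between [x] and [y]: only the nodes move, at fixed bits. *)
  have -> : pat n y w = pat n x w.
    apply/funext => i; apply/esym/setYN => ABw; apply: Bw.
    by rewrite /B -bigcup_seq; exists i; rewrite //= mem_index_enum.
  have := Dye (finfun (pat n x w)).
  rewrite (_ : (finfun (pat n x w) : 'I_n.+1 -> bool) = pat n x w).
    by apply.
  by apply/funext => i; rewrite ffunE.
move=> k; exists (g k); elim: k => [|k IHk].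
  split; first exact/continuous_subspaceT/indicator_family_continuous.
  move=> x _; apply: L0_eqP.
  have := L0_classE mu (mg 0 x).
  have := L0_classE mu (measurable_cindic (R := R) (mA (x 0 0))).
  apply: filterS2 => w -> ->; rewrite indicE.
  rewrite (_ : pat 0 x w = fun=> w \in A (x 0 0)).
    by rewrite divdiff_bool_const andbT rmorph_nat.
  by apply/funext => i; rewrite /pat ord1.
exists (g k) => //; split; first exact/continuous_subspaceT/gc.
move=> x _ x01; apply: L0_eqP.
near=> w.
rewrite (near (L0_ZE (x 0 0 - x 0 1)^-1 (g k (col' 1 x) - g k (col' 0 x))) w)//.
rewrite (near (L0_BE (g k (col' 1 x)) (g k (col' 0 x))) w)//.
rewrite (near (L0_classE mu (mg k.+1 x)) w)//.
rewrite (near (L0_classE mu (mg k (col' 1 x))) w)//.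
rewrite (near (L0_classE mu (mg k (col' 0 x))) w)//.
(* For fixed [w], the recursion at the first two nodes is the required relation. *)
rewrite (divdiff_bool_rec (patS _ _ w) x01).
have patL j : pat k (col' j x) w = pat k.+1 x w \o lift j.
  by apply/funext => i; rewrite /pat /= mxE.
by rewrite !patL.
Unshelve. all: by end_near. Qed.

End indicator_family.

(** * Gauss measure of strips, rectangles and quadrants *)

Lemma normc_ge_Im (R : rcfType) (x : R[i]) : `|complex.Im x|%:C <= `|x|.
Proof. by rewrite normc_def lecR -sqrtr_sqr ler_wsqrtr// lerDr sqr_ge0. Qed.

Section gauss_measure.
Context {R : realType}.
Implicit Types a b : R.

Let C : R := (Num.sqrt pi)^-1.

Let C_gt0 : 0 < C. Proof. by rewrite invr_gt0 sqrtr_gt0 pi_gt0. Qed.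

Let measurable_density (D : set (measurableTypeR R)) :
  measurable_fun D (fun x => (C * expR (- x ^+ 2))%:E).
Proof.
apply/measurable_EFinP/measurable_funM => //.
apply: measurableT_comp => //; apply: measurableT_comp => //.
Qed.

Let lebesgue_itvoc a b : a <= b ->
  (lebesgue_measure (`]a, b]%classic : set (measurableTypeR R)) = (b - a)%:E)%E.
Proof.
move=> ab; rewrite lebesgue_measure_itv/= lte_fin.
by move: ab; rewrite le_eqVlt => /predU1P[->|->//]; rewrite ltxx subrr.
Qed.

(** The Gauss density is at most [C], its value at 0. *)
Lemma gauss_measure_itvoc_le a b : a <= b ->
  (gauss_measure `]a, b] <= (C * (b - a))%:E)%E.
Proof.
move=> ab; rewrite EFinM -lebesgue_itvoc// -integral_cst//.
apply: ge0_le_integral => //.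
move=> x _; rewrite lee_fin -/C.
by rewrite ler_piMr ?(ltW C_gt0)// -expR0 ler_expR oppr_le0 sqr_ge0.
Qed.

Lemma gauss_measure_itvoc_gt0 a b : a < b -> (0 < gauss_measure `]a, b])%E.
Proof.
(* A lower bound for the density on []a, b]], where [x ^+ 2] is at most [b ^+ 2] or [a ^+ 2]
   according to the sign of [x]. *)
move=> ab; pose c := C * expR (- (a ^+ 2 + b ^+ 2)).
have c0 : 0 < c by rewrite mulr_gt0// expR_gt0.
have : (0 < (c * (b - a))%:E)%E.
  by rewrite lte_fin mulr_gt0// subr_gt0.
rewrite EFinM -lebesgue_itvoc ?ltW// -integral_cst// => /lt_le_trans; apply.
apply: ge0_le_integral => //.
- by move=> x _; rewrite lee_fin ltW.
- move=> x /=; rewrite in_itv/= lee_fin => /andP[ax xb].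
  rewrite ler_pM2l// ler_expR lerN2.
  have [x0|x0] := leP 0 (x : R).
    by rewrite ler_wpDl ?sqr_ge0// ler_pXn2r ?nnegrE// (le_trans x0).
  rewrite ler_wpDr ?sqr_ge0// -sqrrN -[leRHS]sqrrN ler_pXn2r ?nnegrE//.
  + by rewrite lerN2 ltW.
  + by rewrite oppr_ge0 ltW.
  + by rewrite oppr_ge0 ltW// (lt_trans ax).
Qed.

Let mu : {finite_measure set R[i] -> \bar R} := @gauss_complex R.

Lemma measurable_rectangle (A B : set (measurableTypeR R)) :
  measurable A -> measurable B ->
  measurable [set w : R[i] | A (complex.Re w) /\ B (complex.Im w)].
Proof.
move=> mA mB; exists (A `*` B); first exact: measurableX.
by rewrite setTI.
Qed.

Lemma gauss_complex_rectangle (A B : set (measurableTypeR R)) :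
  measurable A -> measurable B ->
  (gauss_complex [set w | A (complex.Re w) /\ B (complex.Im w)] =
   gauss_measure A * gauss_measure B)%E.
Proof.
move=> mA mB; rewrite /gauss_complex /distribution /pushforward.
by rewrite -(product_measure1E gauss_measure gauss_measure mA mB).
Qed.

(** A point of the symmetric difference has its real part between those of [z] and [y], or else its
    imaginary part; so two thin strips cover it. *)
Lemma gauss_complex_quadrant_cvg (z : R[i]) (e : R) : 0 < e ->
  \forall y \near z, (mu (quadrant z `+` quadrant y) < e%:E)%E.
Proof.
(* Chosen so that [C * del = e / 2], the bound for each strip. *)
move=> e0; pose del := e / C / 2.
have del0 : 0 < del by rewrite !divr_gt0.
have strip a b : measurable (`]Num.min a b, Num.max a b]%classic :
    set (measurableTypeR R)) by [].
have strip_le a b : `|a - b| < del ->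
    (gauss_measure `]Num.min a b, Num.max a b] < (e / 2)%:E)%E.
  move=> abd; apply: le_lt_trans (gauss_measure_itvoc_le _) _.
    by rewrite le_max ge_min lexx.
  rewrite lte_fin (_ : e / 2 = C * del).
    rewrite ltr_pM2l// (le_lt_trans _ abd)//.
    by case: (leP a b) => ab; [rewrite distrC|]; exact: ler_norm.
  by rewrite /del mulrA mulrCA divff ?mulr1// gt_eqF.
have ozd : nbhs z (ball z del%:C) by apply: nbhsx_ballx; rewrite ltcR.
apply: (filterS _ ozd) => y; rewrite -ball_normE/= => zy.
have Re_zy : `|complex.Re z - complex.Re y| < del.
  rewrite -ltcR (le_lt_trans _ zy)// (le_trans _ (normc_ge_Re _))//.
  by rewrite lecR; case: (z) (y) => ? ? [].
have Im_zy : `|complex.Im z - complex.Im y| < del.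
  rewrite -ltcR (le_lt_trans _ zy)// (le_trans _ (normc_ge_Im _))//.
  by rewrite lecR; case: (z) (y) => ? ? [].
pose S a b := `]Num.min a b, Num.max a b]%classic : set (measurableTypeR R).
have mS a b : measurable (S a b) by exact: measurable_itv.
pose S1 := [set w : R[i] | S (complex.Re z) (complex.Re y) (complex.Re w) /\
  [set: R] (complex.Im w)].
pose S2 := [set w : R[i] | [set: R] (complex.Re w) /\
  S (complex.Im z) (complex.Im y) (complex.Im w)].
have mS1 : measurable S1 by apply: measurable_rectangle => //; exact: mS.
have mS2 : measurable S2 by apply: measurable_rectangle => //; exact: mS.
apply: (@le_lt_trans _ _ (mu (S1 `|` S2))).
  apply: le_measure; rewrite ?inE.
  - rewrite setY_def; apply: measurableU; apply: measurableD;
      exact: measurable_quadrant.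
  - exact: measurableU.
  rewrite setY_def => w [] [/= [wz1 wz2]].
    move=> /not_andP[] /negP; rewrite -ltNge => wy; [left|right];
      by rewrite /S1 /S2 /S/= in_itv/= gt_min le_max ?wz1 ?wz2 wy orbT.
  move=> /not_andP[] /negP; rewrite -ltNge => wy; [left|right];
    by rewrite /S1 /S2 /S/= in_itv/= gt_min le_max ?wz1 ?wz2 wy orbT.
rewrite (le_lt_trans (measureU2 _ _ _))// [e in ltRHS]splitr EFinD lteD//.
  rewrite [X in (X < _)%E]gauss_complex_rectangle//.
  by rewrite probability_setT mule1 strip_le.
rewrite [X in (X < _)%E]gauss_complex_rectangle//.
by rewrite probability_setT mul1e strip_le.
Qed.

(** A nondegenerate rectangle has positive measure, so it does not fit into the null set where [P]
    fails. *)
Lemma ae_meets_rectangle (P : set R[i]) (a b c d : R) : a < b -> c < d ->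
  (\forall w \ae mu, P w) ->
  exists w, [/\ P w, a < complex.Re w <= b & c < complex.Im w <= d].
Proof.
move=> ab cd Pae; apply: contrapT => noP.
pose S := [set w : R[i] |
  (`]a, b]%classic : set (measurableTypeR R)) (complex.Re w) /\
  (`]c, d]%classic : set (measurableTypeR R)) (complex.Im w)].
have : mu S != 0.
  rewrite [X in X != _]gauss_complex_rectangle//.
  by rewrite gt_eqF// mule_gt0// gauss_measure_itvoc_gt0.
apply/negP; rewrite negbK; apply/eqP/measure_negligible.
  exact: measurable_rectangle.
apply: negligibleS Pae => w /= [wab wcd] Pw; apply: noP; exists w.
by split.
Qed.

(** If Re z < Re y, a rectangle with Re z < Re w <= Re y and Im w <= Im y lies in the quadrant of
    [y] and misses that of [z]; likewise for imaginary parts. *)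
Lemma quadrant_indic_le (z y : R[i]) : quadrant_indic z = quadrant_indic y ->
  complex.Re y <= complex.Re z /\ complex.Im y <= complex.Im z.
Proof.
move=> zy.
have /ae_meets_rectangle yz : \forall w \ae mu, quadrant y w -> quadrant z w.
  have := L0_classE mu (measurable_cindic (R := R) (measurable_quadrant z)).
  have := L0_classE mu (measurable_cindic (R := R) (measurable_quadrant y)).
  rewrite -/(quadrant_indic z) -/(quadrant_indic y) zy.
  apply: filterS2 => w -> /eqP; rewrite !indicE => + yw; rewrite mem_set//.
  case: (boolP (w \in quadrant z)) => [/set_mem//|_].
  by rewrite eq_complex/= oner_eq0.
(* The length 1 is an arbitrary choice for the other side of the rectangle. *)
have ltB1 (t : R) : t - 1 < t by rewrite gtrBl.
split; rewrite leNgt; apply/negP => zy1.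
  have [w [yzw /andP[w1 w2] /andP[_ w4]]] :=
    yz _ _ _ _ zy1 (ltB1 (complex.Im y)).
  by have [] := yzw (conj w2 w4); rewrite leNgt w1.
have [w [yzw /andP[_ w2] /andP[w3 w4]]] :=
  yz _ _ _ _ (ltB1 (complex.Re y)) zy1.
by have [_] := yzw (conj w2 w4); rewrite leNgt w3.
Qed.

Lemma quadrant_indic_inj : injective (@quadrant_indic R).
Proof.
move=> z y zy; have [yz1 yz2] := quadrant_indic_le zy.
have [zy1 zy2] := quadrant_indic_le (esym zy).
by apply/eqP; rewrite eq_complex !eq_le yz1 yz2 zy1 zy2.
Qed.

End gauss_measure.

(** * Smoothness, injectivity and failure of the Taylor expansion *)

Theorem proposition1 (R : realType) :
  let f : R[i] -> L0 (@gauss_complex R) := quadrant_indic in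
  is_Cinfty setT f /\ injective f /\
  exists D : nat -> R[i] -> L0 (@gauss_complex R),
    [/\ forall j, is_derivn j f (D j),
        forall j (z : R[i]), (0 < j)%N -> D j z = 0 &
        forall z0 : R[i], ~ \forall z \near z0,
          series (fun j => ((j`!)%:R^-1 * (z - z0) ^+ j) *: D j z0) @ \oo
            --> f z].
Proof.
move=> f; split; last split.
- exact: (indicator_family_Cinfty _ gauss_complex_quadrant_cvg).
- exact: quadrant_indic_inj.
exists (fun j => if j is 0%N then f else fun=> 0); split => [j|[]//|z0 fz0].
  (* The first derivative is that of an indicator family; from the second on, the constant 0 is
     differentiated. *)
  elim: j => [//|[|j] IHj]; eexists; try exact: IHj.
    exact: (indicator_family_deriv _ gauss_complex_quadrant_cvg).
  move=> z; rewrite (_ : (fun t => _) = cst 0); first exact: cvg_cst.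
  by apply/funext => t; rewrite subrr scaler0.
have {fz0} fz0 : \forall z \near z0, f z = f z0.
  move: fz0; apply: filterS => z fz.
  apply: (cvg_unique (@L0_hausdorff _ _ _ _) fz).
  (* Only the term of index 0 survives, so the partial sums equal [f z0] once they are nonempty,
     from index 1 on. *)
  apply: cvg_near_cst; exists 1%N => // n /= n1.
  rewrite /series/= (big_ltn n1) expr0 mulr1 fact0 invr1 scale1r big_nat.
  by rewrite big1 ?addr0// => -[//|j] _; rewrite scaler0.
have [e /= e0 ze] := (@nbhs_ballP _ R[i]^o z0 _).1 fz0.
(* A second point of the ball on which [f] is constant contradicts injectivity. *)
have /quadrant_indic_inj/eqP : f (z0 + e / 2) = f z0.
  apply: ze; rewrite -ball_normE/= opprD addNKr normrN gtr0_norm ?divr_gt0//.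
  by rewrite ltr_pdivrMr// ltr_pMr// ltr1n.
by rewrite -subr_eq0 addrC addKr gt_eqF// divr_gt0.
Qed.
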